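(* Let $(D_k)_{k\ge1}$ be a sequence of directed graphs, where $D_k=(V^{(k)},E^{(k)})$ has $n_k$ vertices and $m_k$ edges, such that $n_k\to\infty$ and the minimum outdegree of $D_k$ tends to infinity as $k\to\infty$. Then there exist bipartitions $V^{(k)}=V_1^{(k)}\cup V_2^{(k)}$ such that $$\min\{e(V_1^{(k)},V_2^{(k)}),\,e(V_2^{(k)},V_1^{(k)})\}\ \ge\ \left(\frac14+o(1)\right)m_k\qquad (k\to\infty).$$ Moreover, the constant $\frac14$ is best possible: the statement becomes false if $\frac14$ is replaced by any larger constant.
   Context: A directed graph $D=(V,E)$ is a finite vertex set $V$ together with a set $E$ of distinct ordered pairs (edges) $\overrightarrow{uv}$ with $u\ne v$; no loops or multiple edges are allowed, but both $\overrightarrow{uv}$ and $\overrightarrow{vu}$ may be present. The minimum outdegree is the minimum over $v\in V$ of the number of out-neighbors of $v$. For $X,Y\subset V$, $e(X,Y)$ is the number of edges $\overrightarrow{xy}\in E$ with $x\in X$, $y\in Y$. A bipartition $V=V_1\cup V_2$ is a partition of $V$ into two disjoint sets. *)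

(* Defs.v *)
From HB Require Import structures.
From mathcomp Require Import all_boot all_order all_algebra.
From mathcomp Require Import all_classical all_reals all_analysis.

Set Implicit Arguments.
Unset Strict Implicit.
Unset Printing Implicit Defensive.

Import Order.TTheory GRing.Theory Num.Theory.
Import numFieldNormedType.Exports.

Local Open Scope ring_scope.

Record digraph := Digraph {
  vertex : finType;
  edges : {set vertex * vertex};
  edges_loopless : forall v : vertex, (v, v) \notin edges
}.

Definition outdegree (D : digraph) (v : vertex D) : nat :=
  #|[set w : vertex D | (v, w) \in edges D]|.

(* Every outdegree is at most #|V|, so the default value is irrelevant as soon
   as there is a vertex; the vertexless digraph gets the value 0. *)
Definition min_outdegree (D : digraph) : nat :=
  \big[minn/#|vertex D|]_(v : vertex D) outdegree v.

Definition edges_between (D : digraph) (X Y : {set vertex D}) : nat :=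
  #|[set p in edges D | (p.1 \in X) && (p.2 \in Y)]|.

(* Parts are allowed to be empty. *)
Definition bipartition (D : digraph) (V1 V2 : {set vertex D}) : Prop :=
  V1 :|: V2 = [set: vertex D] /\ [disjoint V1 & V2].

(* The asymptotic cut statement with constant c; eps is the o(1) term. *)
Definition directed_cut_statement (R : realType) (c : R) : Prop :=
  forall D : nat -> digraph,
    ((fun k => #|vertex (D k)|) @ \oo --> \oo)%classic ->
    ((fun k => min_outdegree (D k)) @ \oo --> \oo)%classic ->
    exists V1 V2 : forall k, {set vertex (D k)},
      (forall k, bipartition (V1 k) (V2 k)) /\
      exists eps : nat -> R,
        (eps @ \oo --> (0 : R))%classic /\
        forall k,
          (c + eps k) * #|edges (D k)|%:R <=
          (minn (edges_between (V1 k) (V2 k)) (edges_between (V2 k) (V1 k)))%:R.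

(* Main.v *)
(** Second moment method.  Place each vertex in V1 or V2 uniformly at random,
with sign s = 1 or -1.  Then 4 e(V1, V2) = m + L - Q and 4 e(V2, V1) = m - L - Q,
where L sums (d+(v) - d-(v)) s(v) over vertices and Q sums s(u) s(w) over edges.
Distinct signs being orthogonal, E L^2 <= 2 n m and E Q^2 <= 2 m, so some
partition has L^2 + Q^2 <= 2 m (n + 1).  Minimum outdegree d forces m >= d n,
so L and Q are O(m / sqrt d), which is o(m).

The constant is sharp for complete digraphs: there e(V1, V2) = |V1| |V2| is at
most n^2 / 4, while m = n (n - 1). *)
Require Import Defs.
From mathcomp Require Import all_boot all_order all_algebra.
From mathcomp Require Import all_classical all_reals all_analysis.
From mathcomp Require Import ring lra.
Import Order.TTheory GRing.Theory Num.Theory.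
Import numFieldNormedType.Exports.
Local Open Scope ring_scope.

(** Expectations over a random subset are written as plain sums over all subsets, and this turns a
    bound on such a sum into a concrete choice. The point [i0] makes [I] nonempty, so summing the
    strict inequalities stays strict. *)
Lemma exists_le_average {R : realDomainType} {I : finType} (i0 : I) (F : I -> R) (b : R) :
  \sum_i F i <= #|I|%:R * b -> exists i, F i <= b.
Proof.
move=> le_sum; apply: contrapT => no_i.
have : \sum_(i : I) b < \sum_i F i.
  apply: ltr_sum; first by apply/hasP; exists i0; rewrite ?mem_index_enum.
  by move=> i _; rewrite ltNge; apply/negP => Fi; apply: no_i; exists i.
by rewrite sumr_const -mulr_natl ltNge le_sum.
Qed.

(** * Moments of uniform random signs *)

Section RandomSigns.
Context {R : realFieldType} {T : finType}.
Implicit Types (S : {set T}) (v w : T) (p q : T * T) (E : {set T * T}).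

Definition sign_of S v : R := if v \in S then 1 else -1.

(** Symmetric difference with the singleton of [v]: a bijection on subsets that changes exactly one
    sign. *)
Definition flip v S : {set T} := if v \in S then S :\ v else v |: S.

Lemma in_flip v S w : (w \in flip v S) = (w == v) (+) (w \in S).
Proof.
rewrite /flip; case: ifP => vS; rewrite !inE; case: eqP => [->|] //=.
  by rewrite vS.
by rewrite vS.
Qed.

Lemma flipK v : involutive (flip v).
Proof. by move=> S; apply/setP => w; rewrite !in_flip addbA addbb. Qed.

Lemma sign_flip v S w :
  sign_of (flip v S) w = if w == v then - sign_of S w else sign_of S w.
Proof.
by rewrite /sign_of in_flip; case: eqP => //= _; case: (w \in S); rewrite ?opprK.
Qed.

(** Reindexing by the involution [flip v] shows that the sum equals its own opposite. *)
Lemma sum_flip_odd v (f : {set T} -> R) :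
  (forall S, f (flip v S) = - f S) -> \sum_S f S = 0.
Proof.
move=> f_odd; have : \sum_S f S = - \sum_S f S.
  rewrite {1}(reindex_inj (inv_inj (flipK v))) -sumrN.
  by apply: eq_bigr => S _; exact: f_odd.
by move/eqP; rewrite -subr_eq0 opprK -mulr2n mulrn_eq0 => /eqP.
Qed.

Lemma sqr_sign S v : sign_of S v * sign_of S v = 1.
Proof. by rewrite /sign_of; case: ifP => _; rewrite ?mulrNN mulr1. Qed.

Lemma sum_sign2 v w :
  \sum_S sign_of S v * sign_of S w = (v == w)%:R * #|{set T}|%:R.
Proof.
case: eqVneq => [->|vw].
  by rewrite mul1r (eq_bigr (fun=> 1)) ?sumr_const // => S _; exact: sqr_sign.
rewrite mul0r; apply: (sum_flip_odd v) => S.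
by rewrite !sign_flip eqxx (eq_sym w) (negPf vw) mulNr.
Qed.

(** Parseval identity: after expanding the square, orthogonality of the signs kills all off-diagonal
    terms. *)
Lemma sum_sqr_linear_sign (c : T -> R) :
  \sum_S (\sum_v c v * sign_of S v) ^+ 2 = #|{set T}|%:R * \sum_v c v ^+ 2.
Proof.
transitivity (\sum_v \sum_w c v * c w * \sum_S sign_of S v * sign_of S w).
  under eq_bigr => S _ do rewrite expr2 mulr_suml.
  rewrite exchange_big /=; apply: eq_bigr => v _.
  under eq_bigr => S _ do rewrite mulr_sumr.
  rewrite exchange_big /=; apply: eq_bigr => w _.
  by rewrite mulr_sumr; apply: eq_bigr => S _; ring.
rewrite mulr_sumr; apply: eq_bigr => v _.
rewrite (bigD1 v) //= [X in _ + X]big1 => [|w wv]; rewrite sum_sign2.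
  by rewrite eqxx mul1r addr0 mulrC expr2.
by rewrite eq_sym (negPf wv) mul0r mulr0.
Qed.

(* If {p.1, p.2} <> {q.1, q.2}, some vertex occurs exactly once among the four,
   and flipping it negates the summand. *)
Lemma sum_sign4_le p q : p.1 != p.2 -> q.1 != q.2 ->
  \sum_S (sign_of S p.1 * sign_of S p.2) * (sign_of S q.1 * sign_of S q.2)
    <= #|{set T}|%:R * (q \in [set p; (p.2, p.1)])%:R.
Proof.
case: p q => [a b] [c d] /= ab cd; rewrite !inE !xpair_eqE.
have odd_le v (f : {set T} -> R) (t : bool) :
    (forall S, f (flip v S) = - f S) -> \sum_S f S <= #|{set T}|%:R * t%:R.
  by move=> /sum_flip_odd ->; rewrite mulr_ge0 // ler0n.
have [ac|ac] := eqVneq c a; last first.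
  have [ad|ad] := eqVneq d a; last first.
    apply: (odd_le a) => S; rewrite !sign_flip eqxx (negPf ac) (negPf ad).
    by rewrite eq_sym (negPf ab); ring.
  have [bc|bc] := eqVneq c b; last first.
    apply: (odd_le b) => S; rewrite !sign_flip eqxx (negPf bc) ad (negPf ab).
    by ring.
  rewrite andbT orbT mulr1 bc ad (eq_bigr (fun=> 1)) ?sumr_const // => S _.
  by rewrite [X in _ * X]mulrC mulrACA !sqr_sign mulr1.
have [bd|bd] := eqVneq d b; last first.
  apply: (odd_le b) => S; rewrite !sign_flip eqxx (negPf bd) ac (negPf ab).
  by ring.
rewrite /= mulr1 ac bd (eq_bigr (fun=> 1)) ?sumr_const // => S _.
by rewrite mulrACA !sqr_sign mulr1.
Qed.

Lemma sum_sqr_quadratic_sign_le E : (forall v, (v, v) \notin E) ->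
  \sum_S (\sum_(p in E) sign_of S p.1 * sign_of S p.2) ^+ 2
    <= #|{set T}|%:R * (2 * #|E|%:R).
Proof.
move=> loopless.
have neq p : p \in E -> p.1 != p.2.
  by case: p => a b; apply: contraTneq => /= ->; exact: loopless.
under eq_bigr => S _ do rewrite expr2 mulr_suml.
rewrite exchange_big /= mulrA mulr_natr -sumr_const.
apply: ler_sum => p pE; under eq_bigr => S _ do rewrite mulr_sumr.
rewrite exchange_big /=.
(* For a fixed edge [p], only [q = p] and the reverse of [p] can contribute, whence the factor 2. *)
apply: le_trans (ler_sum _ (fun q qE => sum_sign4_le p q (neq p pE) (neq q qE))) _.
rewrite -mulr_sumr ler_wpM2l ?ler0n // -natr_sum ler_nat.
rewrite -big_mkcondr /= sum1dep_card.
apply: leq_trans (subset_leq_card _) (_ : #|[set p; (p.2, p.1)]| <= 2)%N.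
  by apply/fintype.subsetP => q; rewrite inE => /andP[].
by rewrite cards2; case: (_ != _).
Qed.

End RandomSigns.

(** * Counting bounds for edges and parts *)

Lemma edges_between_le (D : digraph) (X Y : {set vertex D}) :
  (edges_between X Y <= #|X| * #|Y|)%N.
Proof.
rewrite -cardsX; apply: subset_leq_card; apply/fintype.subsetP => p.
by rewrite !inE => /andP[].
Qed.

Lemma bipartition_card (D : digraph) (X Y : {set vertex D}) :
  bipartition X Y -> (#|X| + #|Y| = #|vertex D|)%N.
Proof.
by case=> XY /disjoint_setI0 XY0; have := cardsUI X Y; rewrite XY XY0 cards0 addn0 cardsT.
Qed.

(** * Balanced cuts in an arbitrary digraph *)

Section Cuts.
Context {R : realType}.
Implicit Types (D : digraph).

Definition indegree D (v : vertex D) : nat :=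
  #|[set w : vertex D | (w, v) \in edges D]|.

Lemma sum_edges_fst D (f : vertex D -> R) :
  \sum_(p in edges D) f p.1 = \sum_v (outdegree v)%:R * f v.
Proof.
transitivity (\sum_v \sum_(w | (v, w) \in edges D) f v).
  by rewrite (pair_big_dep predT (fun v w => (v, w) \in edges D)) /=; apply: eq_bigl => -[].
by apply: eq_bigr => v _; rewrite sumr_const mulr_natl /outdegree cardsE.
Qed.

Lemma sum_edges_snd D (f : vertex D -> R) :
  \sum_(p in edges D) f p.2 = \sum_v (indegree D v)%:R * f v.
Proof.
transitivity (\sum_v \sum_(w | (v, w) \in edges D) f w).
  by rewrite (pair_big_dep predT (fun v w => (v, w) \in edges D)) /=; apply: eq_bigl => -[].
rewrite (exchange_big_dep predT) //=.
by apply: eq_bigr => v _; rewrite sumr_const mulr_natl /indegree cardsE.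
Qed.

Lemma sum_outdegree D : \sum_(v : vertex D) (outdegree v)%:R = #|edges D|%:R :> R.
Proof.
rewrite -sumr_const (sum_edges_fst D (fun=> 1)).
by apply: eq_bigr => v _; rewrite mulr1.
Qed.

Lemma sum_indegree D : \sum_(v : vertex D) (indegree D v)%:R = #|edges D|%:R :> R.
Proof.
rewrite -sumr_const (sum_edges_snd D (fun=> 1)).
by apply: eq_bigr => v _; rewrite mulr1.
Qed.

Lemma min_outdegree_le D (v : vertex D) : (min_outdegree D <= outdegree v)%N.
Proof.
rewrite /min_outdegree; elim: (index_enum _) (mem_index_enum v) => //= w s IHs.
rewrite inE big_cons geq_min => /predU1P[->|/IHs ->]; first by rewrite leqnn.
by rewrite orbT.
Qed.

Lemma min_outdegree_mul_card_le D :
  (min_outdegree D)%:R * #|vertex D|%:R <= #|edges D|%:R :> R.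
Proof.
rewrite -sum_outdegree mulr_natr -sumr_const.
by apply: ler_sum => v _; rewrite ler_nat min_outdegree_le.
Qed.

(** The product of the two factors is 4 when the edge goes from [S] to its complement and 0
    otherwise. *)
Lemma edges_between_sign D (S : {set vertex D}) :
  (edges_between S (~: S))%:R = 4^-1 *
    \sum_(p in edges D) (1 + sign_of S p.1) * (1 - sign_of S p.2) :> R.
Proof.
rewrite mulr_sumr /edges_between -sum1dep_card big_mkcondr /= natr_sum.
apply: eq_bigr => -[u w] _ /=; rewrite /sign_of inE.
by case: (u \in S); case: (w \in S) => /=; field.
Qed.

(* L and Q are the linear and quadratic parts of 4 e(S, ~: S) in the signs. *)
Lemma exists_cut_sqr_le D : exists S : {set vertex D},
  exists L Q : R,
  [/\ L ^+ 2 + Q ^+ 2 <= 2 * #|edges D|%:R * (#|vertex D|%:R + 1),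
      4 * (edges_between S (~: S))%:R = #|edges D|%:R + L - Q &
      4 * (edges_between (~: S) S)%:R = #|edges D|%:R - L - Q].
Proof.
pose n : R := #|vertex D|%:R; pose m : R := #|edges D|%:R.
pose L (S : {set vertex D}) : R := \sum_(p in edges D) (sign_of S p.1 - sign_of S p.2).
pose Q (S : {set vertex D}) : R := \sum_(p in edges D) sign_of S p.1 * sign_of S p.2.
have mE : m = \sum_(p in edges D) 1 by rewrite sumr_const.
have [S leS] : exists S, L S ^+ 2 + Q S ^+ 2 <= 2 * m * (n + 1).
  apply: (exists_le_average (finset.set0 : {set vertex D})).
  (* The bound splits as [2 * m * n] for [L] and [2 * m] for [Q]. *)
  rewrite big_split /= [2 * m * _]mulrDr mulr1 [X in _ <= X]mulrDr lerD //; last first.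
    exact: sum_sqr_quadratic_sign_le (@edges_loopless D).
  pose c v : R := (outdegree v)%:R - (indegree D v)%:R.
  have LE S : L S = \sum_v c v * sign_of S v.
    rewrite /L sumrB sum_edges_fst sum_edges_snd -sumrB.
    by apply: eq_bigr => v _; rewrite mulrBl.
  under eq_bigr => S _ do rewrite LE.
  rewrite sum_sqr_linear_sign ler_wpM2l ?ler0n //.
  (* Both degrees are at most [n], so [c v ^+ 2] is at most [n] times their sum, and all degrees
     together add up to [2 * m]. *)
  apply: (@le_trans _ _ (\sum_v n * ((outdegree v)%:R + (indegree D v)%:R))); last first.
    rewrite -mulr_sumr big_split /= sum_outdegree sum_indegree -/m.
    by lra.
  apply: ler_sum => v _.
  have o_le : (outdegree v)%:R <= n by rewrite ler_nat max_card.
  have i_le : (indegree D v)%:R <= n by rewrite ler_nat max_card.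
  have o2 := ler_wpM2l (ler0n R (outdegree v)) o_le.
  have i2 := ler_wpM2l (ler0n R (indegree D v)) i_le.
  have oi : 0 <= (outdegree v)%:R * (indegree D v)%:R :> R by rewrite mulr_ge0.
  have -> : c v ^+ 2 = (outdegree v)%:R * (outdegree v)%:R
      + (indegree D v)%:R * (indegree D v)%:R
      - 2 * ((outdegree v)%:R * (indegree D v)%:R) by rewrite /c; ring.
  by lra.
exists S, (L S), (Q S); split => //.
  rewrite edges_between_sign mulrA mulfV ?pnatr_eq0 // mul1r.
  rewrite -/m mE /L /Q -big_split /= -sumrB.
  by apply: eq_bigr => p _; ring.
(* Exchanging the two sides negates every sign: [L] changes sign and [Q] does not. *)
have := edges_between_sign D (~: S); rewrite finset.setCK => ->.
rewrite mulrA mulfV ?pnatr_eq0 // mul1r.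
rewrite -/m mE /L /Q -!sumrB.
apply: eq_bigr => p _.
have sC v : sign_of (~: S) v = - sign_of S v :> R.
  by rewrite /sign_of inE; case: (v \in S); rewrite ?opprK.
by rewrite !sC; ring.
Qed.

(** The successor under the root keeps the error term meaningful at minimum outdegree 0; there the
    coefficient is negative and the bound is trivial. *)
Lemma exists_balanced_cut D : exists S : {set vertex D},
  (1 / 4 - (Num.sqrt (min_outdegree D).+1%:R)^-1) * #|edges D|%:R <=
    (minn (edges_between S (~: S)) (edges_between (~: S) S))%:R :> R.
Proof.
have [S [L [Q [leLQ XE YE]]]] := exists_cut_sqr_le D; exists S.
have := min_outdegree_mul_card_le D.
set d := min_outdegree D.
set m : R := #|edges D|%:R in leLQ XE YE *; set n : R := #|vertex D|%:R in leLQ *.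
move=> dn_le_m.
have m_ge0 : 0 <= m by exact: ler0n.
have [d0|d_gt0] := posnP d.
  rewrite d0 sqrtr1 invr1; apply: (@le_trans _ _ 0); last exact: ler0n.
  by nra.
have d_ge1 : 1 <= d%:R :> R by rewrite ler1n.
set r : R := Num.sqrt d.+1%:R.
have r_gt0 : 0 < r by rewrite sqrtr_gt0 ltr0n.
have r2 : r ^+ 2 = d%:R + 1 by rewrite sqr_sqrtr ?ler0n // -natr1.
have [m0|m_neq0] := eqVneq m 0; first by rewrite m0 mulr0 ler0n.
have n_ge1 : 1 <= n.
  rewrite ler1n lt0n; apply: contra_neq m_neq0 => n0.
  by apply/eqP; rewrite pnatr_eq0 -leqn0 (leq_trans (max_card _)) // card_prod n0.
(* Here [x] stands for [L - Q] or [- L - Q]. Since [n + 1 <= 2 * n], its square is at most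
   [8 * m * n]; since [(d + 1) * n <= 2 * d * n <= 2 * m], this is at most
   [16 * m ^+ 2 / (d + 1)]. *)
have sqr_le (x : R) : x ^+ 2 <= 2 * (L ^+ 2 + Q ^+ 2) -> - (4 * (r^-1 * m)) <= x.
  move=> x2; rewrite lerNl; apply: le_trans (ler_norm _) _; rewrite normrN.
  rewrite -(ler_pXn2r (_ : 0 < 2)%N) ?nnegrE ?mulr_ge0 //; last by rewrite invr_ge0 ltW.
  rewrite real_normK ?num_real //; apply: le_trans x2 _.
  have -> : (4 * (r^-1 * m)) ^+ 2 = 16 * m ^+ 2 / (d%:R + 1).
    by rewrite -r2; field; rewrite gt_eqF.
  rewrite ler_pdivlMr; last by lra.
  apply: (@le_trans _ _ (8 * m * n * (d%:R + 1))); first by rewrite ler_wpM2r; nra.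
  have : m * (d%:R + 1) * n <= m * (2 * m) by rewrite -mulrA ler_wpM2l //; nra.
  by lra.
have LQ1 : (L - Q) ^+ 2 <= 2 * (L ^+ 2 + Q ^+ 2) by have := sqr_ge0 (L + Q); nra.
have LQ2 : (- L - Q) ^+ 2 <= 2 * (L ^+ 2 + Q ^+ 2) by have := sqr_ge0 (L - Q); nra.
have := sqr_le _ LQ1; have := sqr_le _ LQ2.
by rewrite /minn; case: ifP => _; lra.
Qed.

End Cuts.

(** * Complete digraphs, the extremal examples *)

Lemma complete_loopless (n : nat) (v : 'I_n) : (v, v) \notin [set p : 'I_n * 'I_n | p.1 != p.2].
Proof. by rewrite inE eqxx. Qed.

Definition complete_digraph (n : nat) : digraph :=
  Digraph (@complete_loopless n).

Lemma outdegree_complete (n : nat) (v : 'I_n) : outdegree (D := complete_digraph n) v = n.-1.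
Proof.
rewrite /outdegree -[RHS](_ : #|[set~ v]| = _); last by rewrite cardsC1 card_ord.
by apply: eq_card => w; rewrite !inE eq_sym.
Qed.

Lemma min_outdegree_complete (n : nat) : (n.-1 <= min_outdegree (complete_digraph n))%N.
Proof.
rewrite /min_outdegree; elim/big_ind: _ => [|x y|v _].
(* The default value of the iterated minimum is [n], which also respects the bound. *)
- by rewrite card_ord leq_pred.
- by rewrite leq_min => -> ->.
- by rewrite outdegree_complete.
Qed.

Lemma card_edges_complete (n : nat) : #|edges (complete_digraph n)| = (n * n.-1)%N.
Proof.
have -> : edges (complete_digraph n) = ~: [set (v, v) | v : 'I_n].
  apply/setP => -[u w]; rewrite !inE /=; congr (~~ _).
  by apply/eqP/imsetP => [->|[x _ [-> ->]]] //; exists w.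
rewrite cardsCs finset.setCK card_imset => [|u w [] //].
by rewrite card_prod card_ord -subn1 mulnBr muln1.
Qed.

Theorem mainTheorem2 (R : realType) :
  directed_cut_statement (1 / 4 : R) /\
  (forall c : R, 1 / 4 < c -> ~ directed_cut_statement c).
Proof.
split.
  move=> D _ mind_oo.
  pose cut k := cid (@exists_balanced_cut R (D k)).
  exists (fun k => sval (cut k)), (fun k => ~: sval (cut k)); split.
    by move=> k; split; [rewrite finset.setUCr | rewrite -finset.setI_eq0 finset.setICr].
  exists (fun k => - (Num.sqrt (min_outdegree (D k)).+1%:R)^-1); split; last by move=> k; exact: svalP (cut k).
  rewrite -oppr0; apply: cvgN.
  apply/cvgr0Pnorm_lt => e e_gt0.
  (* From here on the minimum outdegree exceeds [e^-1 ^+ 2], so the inverse root is below [e]. *)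
  have [N _ NP] := (cvgnyPge _).1 mind_oo (Num.truncn (e^-1 ^+ 2)).+1.
  exists N => // k /NP /= le_d.
  set d := min_outdegree (D k) in le_d *.
  have r_gt0 : 0 < Num.sqrt d.+1%:R :> R by rewrite sqrtr_gt0 ltr0n.
  rewrite gtr0_norm ?invr_gt0 // -[ltRHS]invrK ltf_pV2 ?posrE ?invr_gt0 //.
  have ei_ge0 : 0 <= e^-1 by rewrite invr_ge0 ltW.
  rewrite -[ltLHS]ger0_norm // -sqrtr_sqr ltr_sqrt ?ltr0n //.
  apply: (lt_le_trans (truncnS_gt _)).
  by rewrite ler_nat leqW.
move=> c c_gt cutc.
have [||V1 [V2 [bip [eps [eps0 le_eps]]]]] := cutc (fun k => complete_digraph k.+2).
- by under eq_fun => k do rewrite card_ord; apply/cvgnyPge => N; exists N => // k /= /leqW /leqW.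
- apply/cvgnyPge => N; exists N => // k /= Nk.
  by apply: leq_trans (min_outdegree_complete _); exact: leqW.
(* Half of the gap: once [eps k] is above [- e], the coefficient [c + eps k] still exceeds
   [1 / 4 + e]. *)
pose e := (c - 1 / 4) / 2.
have e_gt0 : 0 < e by rewrite /e; lra.
have [N _ NP] := (cvgr0Pnorm_lt _).1 eps0 e e_gt0.
(* Large enough both for the bound on [eps k] and for [1 < e * k]. *)
pose k := maxn N (Num.truncn e^-1).+1.
have /= eps_lt := NP k (leq_maxl _ _).
have eps_gt : - e < eps k by move: eps_lt; rewrite ltr_norml => /andP[].
have le_ab : (minn (edges_between (V1 k) (V2 k)) (edges_between (V2 k) (V1 k)))%:R <=
   #|V1 k|%:R * #|V2 k|%:R :> R.
  by rewrite -natrM ler_nat (leq_trans (geq_minl _ _)) ?edges_between_le.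
have := le_trans (le_eps k) le_ab; rewrite card_edges_complete /= natrM.
have := congr1 (fun i => i%:R : R) (bipartition_card _ _ _ (bip k)).
rewrite /= card_ord natrD -natr1 -[k.+1%:R]natr1.
have ek : 1 < e * k%:R.
  rewrite mulrC -ltr_pdivrMr // div1r; apply: (lt_le_trans (truncnS_gt _)).
  by rewrite ler_nat leq_maxr.
move: (k%:R) (#|V1 k|%:R) (#|V2 k|%:R) ek => x a b ek abE.
apply/negP; rewrite -ltNge.
have x_gt0 : 0 < x by rewrite -(pmulr_rgt0 _ e_gt0); lra.
(* AM-GM for parts of total size [x + 2]. After cancelling [x + 2] against the edge count
   [(x + 2) * (x + 1)], it remains that [(x + 2) / 4 < (1 / 4 + e) * (x + 1)], which follows from
   [1 < e * x]. *)
have ab4 : a * b <= (x + 1 + 1) * ((x + 1 + 1) / 4).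
  by rewrite -abE; have := sqr_ge0 (a - b); nra.
apply: (le_lt_trans ab4); rewrite [ltRHS]mulrCA ltr_pM2l; last by lra.
apply: (@lt_le_trans _ _ ((1 / 4 + e) * (x + 1))); first by nra.
by rewrite ler_wpM2r //; rewrite /e in eps_gt *; lra.
Qed.
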